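(* For $0<c<1$, $$F_1(c)=\begin{cases}1 & \text{if } 0<c\le \frac{1}{\sqrt2},\\[2mm] \dfrac{1}{\sqrt2\,c} & \text{if } \frac1{\sqrt2}<c<1.\end{cases}$$ Moreover, for $\frac1{\sqrt2}<c<1$ the pair $(p,q)=(1,\sqrt2\,z)$ is an extremal pair for $F_1(c)$, and it is the unique extremal pair up to unimodular constant factors; that is, every extremal pair for $F_1(c)$ is of the form $(e^{is},\,e^{it}\sqrt2\,z)$ with $s,t\in\mathbb{R}$.
   Context: $\mathbb{D}=\{z\in\mathbb{C}:|z|<1\}$. For $f$ analytic on $\mathbb{D}$, $\|f\|_2=\left(\frac1\pi\int_{\mathbb{D}}|f(z)|^2\,dA(z)\right)^{1/2}$, where $dA$ is Lebesgue area measure; the Bergman space $\mathcal{A}^2(\mathbb{D})$ consists of those $f$ with $\|f\|_2<\infty$, and $S^1=\{f\in\mathcal{A}^2(\mathbb{D}):\|f\|_2=1\}$. $\mathcal{P}_1$ is the class of complex polynomials of degree at most $1$. For $0<c<1$, $$F_1(c)=\inf_{p,q\in S^1\cap\mathcal{P}_1}\ \sup_{c\le|z|<1}\left|\frac{p(z)}{q(z)}\right|,$$ where $p/q$ is understood as a meromorphic function (common zeros cancelled, value $\infty$ at poles). A pair $(p,q)$ with $p,q\in S^1\cap\mathcal{P}_1$ is an extremal pair for $F_1(c)$ if $\sup_{c\le|z|<1}|p(z)/q(z)|=F_1(c)$. *)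

(* Defs.v *)
From HB Require Import structures.
From mathcomp Require Import all_boot all_order all_algebra.
From mathcomp Require Import complex.
From mathcomp Require Import all_classical all_reals all_analysis.

Set Implicit Arguments.
Unset Strict Implicit.
Unset Printing Implicit Defensive.

Import Order.TTheory GRing.Theory Num.Theory.
Import numFieldNormedType.Exports.

Local Open Scope classical_set_scope.
Local Open Scope ring_scope.
Local Open Scope complex_scope.

(* The modulus as an element of R; the canonical norm `|z| of R[i] is
   R[i]-valued, and `|z| = (cmod z)%:C. *)
Definition cmod (R : realType) (z : R[i]) : R := complex.Re `|z|.

Definition cexpi (R : realType) (t : R) : R[i] := cos t +i* sin t.

Definition unit_disk (R : realType) : set R[i] := [set z | cmod z < 1].

Definition annulus (R : realType) (c : R) : set R[i] :=
  [set z | c <= cmod z < 1].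

Definition of_pair (R : realType) (w : R * R) : R[i] := w.1 +i* w.2.

(* Since R[i] is taken as a normed module over itself, the increments in
   [derivable f z 1] are complex: this is complex differentiability at z. *)
Definition analytic_on_disk (R : realType) (f : R[i] -> R[i]) : Prop :=
  forall z, unit_disk z -> derivable (f : R[i]^o -> R[i]^o) z 1.

Definition area_measure (R : realType) :=
  (@lebesgue_measure R \x @lebesgue_measure R)%E.

Definition bergman_norm (R : realType) (f : R[i] -> R[i]) : \bar R :=
  (((pi : R)^-1%:E *
    \int[@area_measure R]_(w in @of_pair R @^-1` @unit_disk R)
       (cmod (f (of_pair w)) ^+ 2)%:E) `^ 2^-1)%E.

Definition bergman_space (R : realType) : set (R[i] -> R[i]) :=
  [set f | analytic_on_disk f /\ (bergman_norm f < +oo)%E].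

Definition bergman_sphere (R : realType) : set (R[i] -> R[i]) :=
  [set f | @bergman_space R f /\ bergman_norm f = 1%E].

(* S^1 `&` P_1, with a polynomial identified with its function z |-> p.[z];
   [size p] is the degree plus one. *)
Definition sphere_poly1 (R : realType) : set {poly R[i]} :=
  [set p : {poly R[i]} | (size p <= 2)%N /\ @bergman_sphere R (fun z => p.[z])].

(* |p(z)/q(z)| for the meromorphic function p/q, q != 0: after division by
   the gcd, the zeros of the denominator are exactly the poles. *)
Definition mero_abs (R : realType) (p q : {poly R[i]}) (z : R[i]) : \bar R :=
  let p1 := p %/ gcdp p q in
  let q1 := q %/ gcdp p q in
  if q1.[z] == 0 then +oo%E else (cmod (p1.[z] / q1.[z]))%:E.

Definition annulus_sup (R : realType) (c : R) (p q : {poly R[i]}) : \bar R :=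
  ereal_sup [set mero_abs p q z | z in annulus c].

Definition F1 (R : realType) (c : R) : \bar R :=
  ereal_inf [set annulus_sup c p q
    | p in @sphere_poly1 R & q in @sphere_poly1 R].

Definition extremal_pair (R : realType) (c : R) (p q : {poly R[i]}) : Prop :=
  [/\ sphere_poly1 p, sphere_poly1 q & annulus_sup c p q = F1 c].

(* Main.v *)
Require Import Defs.
From HB Require Import structures.
From mathcomp Require Import all_boot all_order all_algebra.
From mathcomp Require Import complex ring lra.
From mathcomp Require Import all_classical all_reals all_analysis.
From mathcomp Require Import measurable_realfun.

(** Write p = p_0 + p_1 z.  Integrating over the disk gives the squared Bergman
    norm |p_0|^2 + |p_1|^2 / 2 ([bergman_norm_poly1]); on the circle of radius
    [r] the mean of |p|^2 is |p_0|^2 + |p_1|^2 r^2, and the mean over any two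
    opposite points has the same value ([cmod_parallelogram]).  If |p / q| is at
    most [M] on the annulus, these means satisfy the same inequality with factor
    M^2, for every radius in the annulus ([circle_mean_le]).

    At r = 1 / sqrt 2 the mean is the squared norm, so it is 1 for every unit
    polynomial of degree at most 1.  If this radius is available, that is
    c <= 1 / sqrt 2, it follows that 1 <= M^2, with equality for p = q = 1.

    If c > 1 / sqrt 2, then at r = c the mean of a unit polynomial lies between 1
    (attained only by constants) and 2 c^2 (attained only by multiples of z).
    Hence 1 <= M^2 * 2 c^2, and equality forces p to be constant and q to be a
    multiple of z ([mean_at_inner_radius], [extremal_pair_unique]).

    The norm is computed by slicing the disk vertically with Tonelli's theorem
    and applying the fundamental theorem of calculus twice. *)

Set Implicit Arguments.
Unset Strict Implicit.
Unset Printing Implicit Defensive.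

Import Order.TTheory GRing.Theory Num.Theory.
Import numFieldNormedType.Exports.

Local Open Scope classical_set_scope.
Local Open Scope ring_scope.
Local Open Scope complex_scope.

(** * Integration of quadratic polynomials over the disk *)

Definition half_chord (R : realType) (x : R) : R := Num.sqrt (1 - x ^+ 2).

(** Outside [-1, 1] the square root of the negative number is 0 by convention,
    so the interval is empty there, as the slice is: no case distinction on
    [x] is needed. *)
Lemma disk_slice (R : realType) (x y : R) :
  (x ^+ 2 + y ^+ 2 < 1) = (y \in `](- half_chord x), (half_chord x)[).
Proof.
rewrite in_itv /= -ltr_norml /half_chord -sqrtr_sqr.
have [x1|x1] := ltP 0 (1 - x ^+ 2).
  by rewrite ltr_sqrt//; apply/idP/idP; lra.
rewrite (ler0_sqrtr x1) [RHS]ltNge sqrtr_ge0 /=; apply/negbTE; rewrite -leNgt.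
have := sqr_ge0 y; lra.
Qed.

Lemma continuous_half_chord (R : realType) : continuous (@half_chord R).
Proof.
move=> x; apply: (@continuous_comp _ _ _ (fun x : R => 1 - x ^+ 2) Num.sqrt).
  by apply: cvgB; [exact: cvg_cst|exact: exprn_continuous].
exact: sqrt_continuous.
Qed.

Lemma integral_quadratic (R : realType) (A B C s : R) : 0 <= s ->
  (\int[@lebesgue_measure R]_(y in `](- s)%R, s[)
     (A + B * y + C * y ^+ 2)%:E = (2 * A * s + 2 / 3 * C * s ^+ 3)%:E)%E.
Proof.
rewrite le_eqVlt => /predU1P[<-|s0].
  by rewrite oppr0 set_itvoo0 integral_set0; congr EFin; ring.
pose F (y : R) := A * y + B / 2 * y ^+ 2 + C / 3 * y ^+ 3.
have dF (y : R) : is_derive y (1 : R) F (A + B * y + C * y ^+ 2).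
  rewrite /F; apply: is_derive_eq; rewrite /GRing.scale /=; by field.
have cF : continuous F.
  by move=> y; apply/differentiable_continuous/derivable1_diffP; case: (dF y).
have cf : continuous (fun y : R => A + B * y + C * y ^+ 2).
  move=> y; apply: cvgD; first apply: cvgD; first exact: cvg_cst.
    by apply: cvgM; [exact: cvg_cst|exact: cvg_id].
  by apply: cvgM; [exact: cvg_cst|exact: exprn_continuous].
rewrite -(@integral_itv_bndoo _ _ _ _ true false); last first.
  apply/measurable_EFinP/measurable_funTS; exact: continuous_measurable_fun.
rewrite (@continuous_FTC2 _ _ F)//.
- rewrite -EFinB; congr EFin; rewrite /F; by field.
- by rewrite gtrN.
- exact: continuous_subspaceT.
- split.
  + by move=> y _; case: (dF y).
  + exact/cvg_at_right_filter/cF.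
  + exact/cvg_at_left_filter/cF.
- by move=> y _; rewrite derive1E; apply: derive_val.
Qed.

Lemma half_chord_gt0 (R : realType) (x : R) :
  x \in `](-1), 1[ -> 0 < half_chord x.
Proof. by rewrite in_itv /= => /andP[x1 x2]; rewrite sqrtr_gt0; nra. Qed.

Lemma half_chord_sqr (R : realType) (x : R) :
  x \in `](-1), 1[ -> half_chord x ^+ 2 = 1 - x ^+ 2.
Proof. by rewrite in_itv /= => /andP[x1 x2]; rewrite sqr_sqrtr//; nra. Qed.

Lemma is_derive_half_chord (R : realType) (x : R) : x \in `](-1), 1[ ->
  is_derive x (1 : R) (@half_chord R) (- x / half_chord x).
Proof.
rewrite in_itv /= => /andP[x1 x2].
have h : 0 < 1 - x ^+ 2 by nra.
have d1 : is_derive x (1 : R) (fun x : R => 1 - x ^+ 2) (- (2 * x)).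
  apply: is_derive_eq; rewrite /GRing.scale /=; ring.
apply: (is_derive_eq (@is_derive1_comp _ Num.sqrt (fun x => 1 - x ^+ 2) _ _ _
  (is_derive1_sqrt h) d1)).
rewrite /half_chord.
have s0 : Num.sqrt (1 - x ^+ 2) != 0 by rewrite gt_eqF ?sqrtr_gt0.
rewrite /GRing.scale /=.
by field.
Qed.

(** The arcsine of [x], written through the half-angle tangent: unlike the
    inverse of the sine on its interval, this expression is visibly continuous
    on the whole line, including the endpoints -1 and 1 that the fundamental
    theorem of calculus needs. *)
Definition half_angle_asin (R : realType) (x : R) : R :=
  2 * atan (x / (1 + half_chord x)).

Lemma is_derive_half_angle_asin (R : realType) (x : R) : x \in `](-1), 1[ ->
  is_derive x (1 : R) (@half_angle_asin R) (half_chord x)^-1.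
Proof.
move=> x1; have := is_derive_half_chord x1 => hs.
have sp := half_chord_gt0 x1.
have s2 := half_chord_sqr x1.
have dq : is_derive x (1 : R) (fun x => x / (1 + half_chord x))
   (half_chord x * (1 + half_chord x))^-1.
  have n1 : 1 + half_chord x != 0 by rewrite gt_eqF ?addr_gt0.
  have d1 : is_derive x (1 : R) (fun x => 1 + half_chord x) (- x / half_chord x).
    apply: (is_derive_eq (is_deriveD (is_derive_cst (1 : R) x (1 : R)) hs)).
    by rewrite add0r.
  have dV := is_deriveV (f := fun x : R => 1 + half_chord x) n1 d1.
  apply: (is_derive_eq (is_deriveM (is_derive_id x (1 : R)) dV)).
  rewrite /GRing.scale /= mulr1.
  have E : x ^+ 2 = 1 - half_chord x ^+ 2 by rewrite s2; ring.
  transitivity ((half_chord x + half_chord x ^+ 2 + x ^+ 2) /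
      (half_chord x * (1 + half_chord x) ^+ 2)).
    by field; rewrite n1 gt_eqF.
  rewrite E; by field; rewrite n1 gt_eqF.
have h := is_derive1_comp (g := fun x : R => x / (1 + half_chord x)) (is_derive1_atan _) dq.
apply: (is_derive_eq (is_deriveZ 2 h)).
rewrite /GRing.scale /=.
have n1 : 1 + half_chord x != 0 by rewrite gt_eqF ?addr_gt0.
have E : x ^+ 2 = 1 - half_chord x ^+ 2 by rewrite s2; ring.
rewrite expr_div_n E.
have -> : 1 + (1 - half_chord x ^+ 2) / (1 + half_chord x) ^+ 2 = 2 / (1 + half_chord x) by field.
by field; rewrite n1 gt_eqF.
Qed.

Lemma continuous_half_angle_asin (R : realType) : continuous (@half_angle_asin R).
Proof.
move=> x; apply: cvgM; first exact: cvg_cst.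
apply: (@continuous_comp _ _ _ (fun x : R => x / (1 + half_chord x)) atan);
  last exact: continuous_atan.
apply: cvgM; first exact: cvg_id.
apply: cvgV; first by rewrite gt_eqF// ltr_pwDl// sqrtr_ge0.
apply: cvgD; [exact: cvg_cst|exact: continuous_half_chord].
Qed.

Lemma half_chord1 (R : realType) : half_chord (1 : R) = 0.
Proof. by rewrite /half_chord expr1n subrr sqrtr0. Qed.

Lemma half_chordN1 (R : realType) : half_chord (- 1 : R) = 0.
Proof. by rewrite /half_chord sqrrN expr1n subrr sqrtr0. Qed.

(** With [s] the half chord at [x], an antiderivative of the integrand is
    (K + L/2) asin x + s Q(x) with a polynomial [Q].  As [s] vanishes at both
    endpoints, only the arcsine contributes, with total variation [pi]. *)
Lemma integral_slices (R : realType) (K u L : R) :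
  (\int[@lebesgue_measure R]_(x in `[(- 1)%R, 1%R])
     (2 * (K + 2 * u * x + L * x ^+ 2) * half_chord x
      + 2 / 3 * L * half_chord x ^+ 3)%:E = (pi * (K + L / 2))%:E)%E.
Proof.
(* Antiderivatives of s, x s, x^2 s and s^3 are combinations of asin x, s and
   s^3 with polynomial coefficients; writing s^3 = s (1 - x^2) leaves a single
   polynomial factor of s. *)
pose Q (x : R) := K * x - 4 / 3 * u * (1 - x ^+ 2) + L * (x / 6 + x ^+ 3 / 3).
pose F (x : R) := (K + L / 2) * half_angle_asin x + half_chord x * Q x.
have dQ (x : R) : is_derive x (1 : R) Q (K + 8 / 3 * u * x + L * (6^-1 + x ^+ 2)).
  rewrite /Q; apply: is_derive_eq; rewrite /GRing.scale /=; by field.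
have dF (x : R) : x \in `](-1), 1[ -> is_derive x (1 : R) F
    (2 * (K + 2 * u * x + L * x ^+ 2) * half_chord x
      + 2 / 3 * L * half_chord x ^+ 3).
  move=> x1.
  have sp := half_chord_gt0 x1.
  have s2 := half_chord_sqr x1.
  apply: (is_derive_eq (is_deriveD (is_deriveZ (K + L / 2) (is_derive_half_angle_asin x1))
     (is_deriveM (is_derive_half_chord x1) (dQ x)))).
  rewrite /GRing.scale /=.
  have -> : half_chord x ^+ 3 = half_chord x * (1 - x ^+ 2) by rewrite -s2; ring.
  have -> : (half_chord x)^-1 = half_chord x / (1 - x ^+ 2)
    by rewrite -s2; field; rewrite gt_eqF.
  have n : 1 - x ^+ 2 != 0 by rewrite -s2 gt_eqF ?exprn_gt0.
  by rewrite /Q; field.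
have cF : continuous F.
  move=> x; apply: cvgD.
    by apply: cvgM; [exact: cvg_cst|exact: continuous_half_angle_asin].
  apply: cvgM; first exact: continuous_half_chord.
  by apply/differentiable_continuous/derivable1_diffP; case: (dQ x).
have cf : continuous (fun x : R => 2 * (K + 2 * u * x + L * x ^+ 2) * half_chord x
      + 2 / 3 * L * half_chord x ^+ 3).
  move=> x; apply: cvgD; apply: cvgM.
  - apply: cvgM; first exact: cvg_cst.
    apply: cvgD; first apply: cvgD; first exact: cvg_cst.
      by apply: cvgM; [exact: cvg_cst|exact: cvg_id].
    by apply: cvgM; [exact: cvg_cst|exact: exprn_continuous].
  - exact: continuous_half_chord.
  - exact: cvg_cst.
  - apply: (@continuous_comp _ _ _ (@half_chord R) (fun x => x ^+ 3));
      [exact: continuous_half_chord|exact: exprn_continuous].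
rewrite (@continuous_FTC2 _ _ F)//.
- rewrite -EFinB; congr EFin; rewrite /F /half_angle_asin half_chord1.
  rewrite half_chordN1 addr0 !divr1 atanN atan1.
  by field.
- exact: continuous_subspaceT.
- split.
  + by move=> x x1; case: (dF x x1).
  + exact/cvg_at_right_filter/cF.
  + exact/cvg_at_left_filter/cF.
- by move=> x x1; rewrite derive1E; have := dF x x1; case.
Qed.

Lemma measurable_sum_squares (R : realType) :
  measurable_fun [set: R * R] (fun w : R * R => w.1 ^+ 2 + w.2 ^+ 2).
Proof.
apply: measurable_funD; apply: measurable_funX.
  exact: measurable_fst.
exact: measurable_snd.
Qed.

(** The linear terms drop out and the quadratic one has mean value 1/2 over the
    disk.  The sign hypothesis is what Tonelli's theorem asks for; it holds when
    the quadratic polynomial is the squared modulus of a complex one. *)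
Lemma integral_disk (R : realType) (K u v L : R) :
  (forall x y, 0 <= K + 2 * u * x + 2 * v * y + L * (x ^+ 2 + y ^+ 2)) ->
  (\int[@area_measure R]_(w in [set w : R * R | (w.1 ^+ 2 + w.2 ^+ 2 < 1)%R])
     (K + 2 * u * w.1 + 2 * v * w.2 + L * (w.1 ^+ 2 + w.2 ^+ 2))%:E
   = (pi * (K + L / 2))%:E)%E.
Proof.
move=> f0; set D := [set w | _].
pose f (w : R * R) := K + 2 * u * w.1 + 2 * v * w.2 + L * (w.1 ^+ 2 + w.2 ^+ 2).
have mD : measurable D.
  rewrite (_ : D = setT `&` (fun w : R * R => w.1 ^+ 2 + w.2 ^+ 2) @^-1`
    `]-oo, 1[%classic); last first.
    by rewrite setTI; apply/seteqP; split => w; rewrite /D /= in_itv.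
  exact: measurable_sum_squares.
have mf : measurable_fun setT f.
  apply: measurable_funD; last first.
    by apply: measurable_funM; [exact: measurable_cst|exact: measurable_sum_squares].
  apply: measurable_funD; first apply: measurable_funD.
  - exact: measurable_cst.
  - by apply: measurable_funM; [exact: measurable_cst|exact: measurable_fst].
  - by apply: measurable_funM; [exact: measurable_cst|exact: measurable_snd].
rewrite integral_mkcond /area_measure fubini_tonelli1; last 2 first.
- apply/(measurable_restrictT _ mD)/measurable_funTS; exact/measurable_EFinP.
- by move=> w; apply: erestrict_ge0 => z _; rewrite lee_fin f0.
rewrite -(integral_slices K u L) [RHS]integral_mkcond.
apply: eq_integral => x _; rewrite /fubini_F patchE.
transitivity (\int[@lebesgue_measure R]_(y in `](- half_chord x)%R, (half_chord x)[)
   ((K + 2 * u * x + L * x ^+ 2) + (2 * v) * y + L * y ^+ 2)%:E)%E.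
  rewrite [RHS]integral_mkcond; apply: eq_integral => y _; rewrite !patchE.
  have -> : ((x, y) \in D) = (y \in `](- half_chord x), (half_chord x)[%classic).
    by apply/idP/idP; rewrite !inE /D /= disk_slice.
  case: ifP => // _; congr EFin; rewrite /=; ring.
rewrite integral_quadratic ?sqrtr_ge0//.
case: ifPn => [_|]; first by congr EFin; ring.
rewrite mem_setE in_itv /= => x1.
have -> : half_chord x = 0.
  apply: ler0_sqrtr; move: x1; rewrite negb_and -!ltNge => /orP[] ?; nra.
by congr EFin; ring.
Qed.

(** * The modulus of a complex number *)

Lemma cmod_sqr (R : realType) (z : R[i]) :
  cmod z ^+ 2 = complex.Re z ^+ 2 + complex.Im z ^+ 2.
Proof. by case: z => a b; rewrite /cmod normc_def /= sqr_sqrtr// addr_ge0 ?sqr_ge0. Qed.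

Lemma cmod_ge0 (R : realType) (z : R[i]) : 0 <= cmod z.
Proof. by case: z => a b; rewrite /cmod normc_def /= sqrtr_ge0. Qed.

Lemma cmodM (R : realType) (z w : R[i]) : cmod (z * w) = cmod z * cmod w.
Proof.
by rewrite /cmod normrM !normc_def /= mulr0 subr0.
Qed.

Lemma cmod_real (R : realType) (r : R) : 0 <= r -> cmod r%:C = r.
Proof. by move=> r0; rewrite /cmod normc_def /= expr0n addr0 sqrtr_sqr ger0_norm. Qed.

Lemma cmod0 (R : realType) : cmod (0 : R[i]) = 0.
Proof. by rewrite /cmod normr0. Qed.

Lemma cmod1 (R : realType) : cmod (1 : R[i]) = 1.
Proof. by rewrite /cmod normr1. Qed.

Lemma cmod_eq0 (R : realType) (z : R[i]) : cmod z ^+ 2 = 0 -> z = 0.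
Proof.
rewrite cmod_sqr => /eqP; rewrite paddr_eq0 ?sqr_ge0// !sqrf_eq0.
by case: z => x y /= /andP[/eqP-> /eqP->].
Qed.

Lemma cmod1_cexpi (R : realType) (z : R[i]) : cmod z = 1 -> exists t : R, z = cexpi t.
Proof.
move=> z1; have := cmod_sqr z; rewrite z1 expr1n; case: z {z1} => x y /= xy.
have xb : -1 <= x <= 1 by rewrite -ler_norml -(@expr_le1 _ 2)// real_normK ?num_real//; nra.
have sE : Num.sqrt (1 - x ^+ 2) = `|y|.
  by rewrite -sqrtr_sqr; congr Num.sqrt; lra.
have [y0|y0] := leP 0 y.
  by exists (acos x); rewrite /cexpi acosK// sin_acos// sE ger0_norm.
by exists (- acos x); rewrite /cexpi cosN sinN acosK// sin_acos// sE ltr0_norm// opprK.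
Qed.

(** Half of the left-hand side stands in for the mean of |a + b z|^2 over the
    circle of radius |z|: already two opposite points average out the cross
    term. *)
Lemma cmod_parallelogram (R : realType) (a b z : R[i]) :
  cmod (a + b * z) ^+ 2 + cmod (a + b * - z) ^+ 2
  = 2 * (cmod a ^+ 2 + cmod b ^+ 2 * cmod z ^+ 2).
Proof. rewrite !cmod_sqr; case: a b z => [a1 a2] [b1 b2] [z1 z2] /=; ring. Qed.

(** * The Bergman norm in degree at most one *)

Lemma poly_size2E (R : realType) (p : {poly R[i]}) : (size p <= 2)%N ->
  p = (p`_0)%:P + p`_1 *: 'X.
Proof.
move=> sp; apply/polyP => -[|[|i]]; rewrite coefD coefC coefZ coefX /=.
- by rewrite mulr0 addr0.
- by rewrite mulr1 add0r.
- by rewrite mulr0 addr0 nth_default// (leq_trans sp).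
Qed.

Lemma horner_size2 (R : realType) (p : {poly R[i]}) z : (size p <= 2)%N ->
  p.[z] = p`_0 + p`_1 * z.
Proof.
by move=> sp; rewrite (horner_coef_wide z sp)
  !big_ord_recl big_ord0 /= expr0 mulr1 expr1 addr0.
Qed.

(** The square of the Bergman norm of a polynomial of degree at most 1: the
    monomials are orthogonal and z has squared norm 1/2. *)
Definition coef_norm_sqr (R : realType) (p : {poly R[i]}) : R :=
  cmod p`_0 ^+ 2 + cmod p`_1 ^+ 2 / 2.

Lemma bergman_norm_poly1 (R : realType) (p : {poly R[i]}) : (size p <= 2)%N ->
  bergman_norm (fun z => p.[z]) = (Num.sqrt (coef_norm_sqr p))%:E.
Proof.
move=> sp; rewrite /bergman_norm.
pose a := p`_0; pose b := p`_1.
(* Here a + b z has squared modulus |a|^2 + 2 Re (conj a * b * z) + |b|^2 |z|^2,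
   and conj a * b = u - i v. *)
pose u := complex.Re a * complex.Re b + complex.Im a * complex.Im b.
pose v := complex.Im a * complex.Re b - complex.Re a * complex.Im b.
have E (w : R * R) : cmod p.[of_pair w] ^+ 2 =
   cmod a ^+ 2 + 2 * u * w.1 + 2 * v * w.2 + cmod b ^+ 2 * (w.1 ^+ 2 + w.2 ^+ 2).
  rewrite horner_size2// !cmod_sqr -/a -/b /u /v /of_pair.
  case: (a) => a1 a2; case: (b) => b1 b2 /=; ring.
have -> : @of_pair R @^-1` @unit_disk R = [set w | (w.1 ^+ 2 + w.2 ^+ 2 < 1)%R].
  apply/seteqP; split => w /=; rewrite /unit_disk /= /of_pair /=.
    move=> h; have := cmod_sqr (w.1 +i* w.2) => /= <-.
    by rewrite expr_lt1// cmod_ge0.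
  by have := cmod_sqr (w.1 +i* w.2) => /= <-; rewrite expr_lt1// cmod_ge0.
under eq_integral do rewrite E.
rewrite integral_disk; last first.
  by move=> x y; rewrite -(E (x, y)) sqr_ge0.
rewrite -EFinM mulrA mulVf ?mul1r ?gt_eqF ?pi_gt0// poweR_EFin powR12_sqrt//.
by rewrite addr_ge0 ?divr_ge0 ?sqr_ge0.
Qed.

Lemma sphere_poly1P (R : realType) (p : {poly R[i]}) :
  sphere_poly1 p <-> (size p <= 2)%N /\ coef_norm_sqr p = 1.
Proof.
have n0 : 0 <= coef_norm_sqr p by rewrite addr_ge0 ?divr_ge0 ?sqr_ge0.
split.
  move=> [sp [_]]; rewrite bergman_norm_poly1// => -[] h; split => //.
  by rewrite -(sqr_sqrtr n0) h expr1n.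
move=> [sp h]; split => //; rewrite /bergman_sphere /= bergman_norm_poly1// h sqrtr1; split => //.
split; last by rewrite bergman_norm_poly1// ltry.
move=> z _; rewrite (_ : (fun z => p.[z]) = (fun z : R[i]^o => p`_0 + p`_1 * z)); last first.
  by apply/funext => w; exact: horner_size2.
apply: derivableD; first exact: derivable_cst.
apply: derivableM; first exact: derivable_cst.
exact: derivable_id.
Qed.

(** * Circle means and the supremum over the annulus *)

Lemma mero_abs_ge0 (R : realType) (p q : {poly R[i]}) z : (0 <= mero_abs p q z)%E.
Proof. by rewrite /mero_abs; case: ifP => // _; rewrite lee_fin cmod_ge0. Qed.

Lemma horner_divp_gcdp (R : realType) (p q : {poly R[i]}) z :
  p.[z] = (p %/ gcdp p q).[z] * (gcdp p q).[z] /\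
  q.[z] = (q %/ gcdp p q).[z] * (gcdp p q).[z].
Proof. by rewrite -!hornerM !divpK ?dvdp_gcdl ?dvdp_gcdr. Qed.

Lemma mero_absE (R : realType) (p q : {poly R[i]}) z : q.[z] != 0 ->
  mero_abs p q z = (cmod (p.[z] / q.[z]))%:E.
Proof.
have [Ep Eq] := horner_divp_gcdp p q z.
move=> qz; move: (qz); rewrite {1}Eq mulf_eq0 negb_or => /andP[q1z gz].
by rewrite /mero_abs (negbTE q1z) Ep Eq -mulf_div divff// mulr1.
Qed.

(** Multiplying back by the common factor turns a bound on the quotient into an
    inequality that also holds at the common zeros. *)
Lemma cmod_horner_le (R : realType) (p q : {poly R[i]}) z (M : R) :
  (mero_abs p q z <= M%:E)%E -> cmod p.[z] <= M * cmod q.[z].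
Proof.
have [Ep Eq] := horner_divp_gcdp p q z.
rewrite /mero_abs; case: eqP => [_|/eqP q1z]; first by rewrite leye_eq.
rewrite lee_fin => h; rewrite Ep Eq !cmodM mulrA ler_wpM2r ?cmod_ge0//.
by rewrite -[X in cmod X](divfK q1z) cmodM ler_wpM2r ?cmod_ge0.
Qed.

(** Squaring |p| <= M |q| and averaging over the circle of radius [r] inside
    the annulus leaves an inequality between the moduli of the coefficients. *)
Lemma circle_mean_le (R : realType) (c r M : R) (p q : {poly R[i]}) :
  0 <= c -> c <= r < 1 -> (size p <= 2)%N -> (size q <= 2)%N ->
  (annulus_sup c p q <= M%:E)%E ->
  cmod p`_0 ^+ 2 + cmod p`_1 ^+ 2 * r ^+ 2
    <= M ^+ 2 * (cmod q`_0 ^+ 2 + cmod q`_1 ^+ 2 * r ^+ 2).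
Proof.
move=> c0 cr sp sq hM.
have r0 : 0 <= r by case/andP: cr => /(le_trans c0).
have H z : cmod z = r -> cmod p.[z] ^+ 2 <= M ^+ 2 * cmod q.[z] ^+ 2.
  move=> zr; rewrite -exprMn.
  have h : cmod p.[z] <= M * cmod q.[z].
    apply/cmod_horner_le/le_trans/hM/ereal_sup_ubound; exists z => //.
    by rewrite /annulus /= zr.
  by rewrite lerXn2r// nnegrE ?cmod_ge0// (le_trans _ h)// cmod_ge0.
have zr := cmod_real r0.
have zNr : cmod (- r%:C) = r by rewrite /cmod normrN.
have := lerD (H _ zr) (H _ zNr).
rewrite -mulrDr !horner_size2// !cmod_parallelogram zr.
by rewrite [X in _ <= X -> _]mulrCA ler_pM2l.
Qed.

(** The supremum may be infinite; it is never negative because the annulus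
    contains the point [r].  So lower bounds need only be checked against finite
    nonnegative upper bounds [M]. *)
Lemma annulus_sup_ge (R : realType) (c r m : R) (p q : {poly R[i]}) :
  0 <= c -> c <= r < 1 -> 0 <= m ->
  (forall M, 0 <= M -> (annulus_sup c p q <= M%:E)%E -> m <= M) ->
  (m%:E <= annulus_sup c p q)%E.
Proof.
move=> c0 cr m0 h.
have r0 : 0 <= r by case/andP: cr => /(le_trans c0).
have s0 : (0 <= annulus_sup c p q)%E.
  apply: (le_trans (mero_abs_ge0 p q r%:C)); apply: ereal_sup_ubound.
  by exists r%:C => //; rewrite /annulus /= cmod_real.
case E : (annulus_sup c p q) s0 => [M| |] //; rewrite ?leey// !lee_fin => M0.
by apply: h => //; rewrite E.
Qed.

(** * Lower bounds *)

Lemma sqrt2_inv_sqr (R : realType) : ((Num.sqrt (2 : R))^-1) ^+ 2 = 2^-1.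
Proof. by rewrite exprVn sqr_sqrtr. Qed.

Lemma sqrt2_inv_bounds (R : realType) : 0 < (Num.sqrt (2 : R))^-1 < 1.
Proof.
rewrite invr_gt0 sqrtr_gt0 ltr0n /= invf_lt1 ?sqrtr_gt0//.
by rewrite -[X in X < _]sqrtr1 ltr_sqrt// ltr1n.
Qed.

(** At radius 1 / sqrt 2 the circle mean of |p|^2 is the squared Bergman norm,
    hence equal to 1 for both polynomials. *)
Lemma annulus_sup_ge1 (R : realType) (c : R) (p q : {poly R[i]}) :
  0 < c -> c <= (Num.sqrt 2)^-1 -> sphere_poly1 p -> sphere_poly1 q ->
  (1 <= annulus_sup c p q)%E.
Proof.
move=> c0 c2 /sphere_poly1P[sp np] /sphere_poly1P[sq nq].
have /andP[_ r1] := sqrt2_inv_bounds R.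
have cr : c <= (Num.sqrt (2 : R))^-1 < 1 by rewrite c2.
apply: (annulus_sup_ge (ltW c0) cr) => // M M0 hM.
have := circle_mean_le (ltW c0) cr sp sq hM.
rewrite sqrt2_inv_sqr -/(coef_norm_sqr p) -/(coef_norm_sqr q) np nq mulr1.
by move=> h; nra.
Qed.

(** The inequality of circle means at radius [c], with |p_0| and |q_1|
    eliminated by the normalisation.  For 2 c^2 > 1 the terms in |p_1| and |q_0| both work
    against a small [M], and each must vanish when [M] is optimal. *)
Lemma mean_at_inner_radius (R : realType) (c M : R) (p q : {poly R[i]}) :
  0 < c -> c < 1 -> (size p <= 2)%N -> (size q <= 2)%N ->
  coef_norm_sqr p = 1 -> coef_norm_sqr q = 1 ->
  (annulus_sup c p q <= M%:E)%E ->
  1 + cmod p`_1 ^+ 2 * (c ^+ 2 - 2^-1)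
  <= M ^+ 2 * (2 * c ^+ 2 - cmod q`_0 ^+ 2 * (2 * c ^+ 2 - 1)).
Proof.
move=> c0 c1 sp sq np nq hM.
have cr : c <= c < 1 by rewrite lexx.
have := circle_mean_le (ltW c0) cr sp sq hM; move: np nq; rewrite /coef_norm_sqr.
move: (cmod p`_0 ^+ 2) (cmod p`_1 ^+ 2) (cmod q`_0 ^+ 2) (cmod q`_1 ^+ 2)
  => P0 P1 Q0 Q1 np nq.
have -> : P0 = 1 - P1 / 2 by lra.
have -> : Q1 = 2 * (1 - Q0) by lra.
congr (_ <= _); ring.
Qed.

Lemma sqrt2_inv_lt_sqr (R : realType) (c : R) : (Num.sqrt 2)^-1 < c -> 1 < 2 * c ^+ 2.
Proof.
have /andP[r0 _] := sqrt2_inv_bounds R; have := sqrt2_inv_sqr R.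
by move: (Num.sqrt 2)^-1 r0 => r r0 r2 rc; nra.
Qed.

Lemma inner_value_sqr (R : realType) (c : R) :
  ((Num.sqrt 2 * c)^-1) ^+ 2 = (2 * c ^+ 2)^-1.
Proof. by rewrite exprVn exprMn sqr_sqrtr. Qed.

(** When 2 c^2 > 1, dropping the two coefficient terms only weakens the inequality
    of means, to 1 <= M^2 * 2 c^2. *)
Lemma annulus_sup_ge_inner (R : realType) (c : R) (p q : {poly R[i]}) :
  0 < c -> c < 1 -> (Num.sqrt 2)^-1 < c -> sphere_poly1 p -> sphere_poly1 q ->
  ((Num.sqrt 2 * c)^-1%:E <= annulus_sup c p q)%E.
Proof.
move=> c0 c1 /sqrt2_inv_lt_sqr c2 /sphere_poly1P[sp np] /sphere_poly1P[sq nq].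
have cr : c <= c < 1 by rewrite lexx.
apply: (annulus_sup_ge (ltW c0) cr) => [|M M0 hM].
  by rewrite invr_ge0 mulr_ge0 ?sqrtr_ge0 ?ltW.
have := mean_at_inner_radius c0 c1 sp sq np nq hM.
have := sqr_ge0 (cmod p`_1); have := sqr_ge0 (cmod q`_0).
move: (cmod p`_1 ^+ 2) (cmod q`_0 ^+ 2) => P1 Q0 Q00 P10 h.
have h2 : 1 <= M ^+ 2 * (2 * c ^+ 2).
  apply: le_trans (le_trans h _).
    by rewrite lerDl mulr_ge0//; lra.
  by rewrite ler_wpM2l ?sqr_ge0// gerBl mulr_ge0//; lra.
rewrite -(@ler_pXn2r _ 2) ?nnegrE ?invr_ge0 ?mulr_ge0 ?sqrtr_ge0 ?(ltW c0)//.
by rewrite inner_value_sqr -[_^-1]mul1r ler_pdivrMr//; lra.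
Qed.

(** * Extremal pairs *)

Lemma annulus_sup11 (R : realType) (c : R) : (annulus_sup c (1 : {poly R[i]}) 1 <= 1)%E.
Proof.
apply: ge_ereal_sup => _ [z _ <-].
by rewrite mero_absE hornerC ?oner_neq0// divr1 lee_fin /cmod normr1.
Qed.

Lemma annulus_sup1X (R : realType) (c : R) : 0 < c ->
  (annulus_sup c 1 ((Num.sqrt 2)%:C *: 'X) <= (Num.sqrt 2 * c)^-1%:E)%E.
Proof.
move=> c0; apply: ge_ereal_sup => _ [z /andP[cz _] <-].
have s0 : 0 < Num.sqrt (2 : R) by rewrite sqrtr_gt0.
have z0 : 0 < cmod z by apply: lt_le_trans cz.
have E : ((Num.sqrt 2)%:C *: 'X).[z] = (Num.sqrt 2)%:C * z by rewrite hornerZ hornerX.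
have cE : cmod ((Num.sqrt 2)%:C * z) = Num.sqrt 2 * cmod z.
  by rewrite cmodM cmod_real ?ltW.
have n0 : (Num.sqrt 2)%:C * z != 0.
  apply/eqP => e; move: cE; rewrite e cmod0 => /esym/eqP.
  by rewrite gt_eqF ?mulr_gt0.
rewrite mero_absE E// hornerC lee_fin.
have -> : cmod (1 / ((Num.sqrt 2)%:C * z)) = (Num.sqrt 2 * cmod z)^-1.
  apply: (@mulIf _ (cmod ((Num.sqrt 2)%:C * z))); first by rewrite cE gt_eqF ?mulr_gt0.
  rewrite -cmodM divfK// cE mulVf ?gt_eqF ?mulr_gt0//.
  by rewrite cmod1.
by rewrite lef_pV2 ?posrE ?mulr_gt0// ler_pM2l.
Qed.

Lemma sphere_poly1_1 (R : realType) : sphere_poly1 (1 : {poly R[i]}).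
Proof.
apply/sphere_poly1P; split; first by rewrite size_poly1.
by rewrite /coef_norm_sqr !coef1 /= cmod0 cmod1 expr1n expr0n mul0r addr0.
Qed.

Lemma sphere_poly1_sqrt2X (R : realType) :
  sphere_poly1 ((Num.sqrt 2)%:C *: 'X : {poly R[i]}).
Proof.
apply/sphere_poly1P; split.
  by rewrite (leq_trans (size_scale_leq _ _))// size_polyX.
rewrite /coef_norm_sqr !coefZ !coefX /= mulr0 mulr1 cmod0.
by rewrite cmod_real ?sqrtr_ge0// sqr_sqrtr// expr0n add0r divff.
Qed.

Lemma F1_small (R : realType) (c : R) : 0 < c -> c <= (Num.sqrt 2)^-1 -> F1 c = 1%E.
Proof.
move=> c0 c2; apply/eqP; rewrite eq_le; apply/andP; split.
  apply: le_trans (annulus_sup11 c).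
  apply: ereal_inf_lbound; exists 1; first exact: sphere_poly1_1.
  by exists 1 => //; exact: sphere_poly1_1.
by apply: le_ereal_inf_tmp => _ [p sp [q sq <-]]; exact: annulus_sup_ge1.
Qed.

Lemma F1_large (R : realType) (c : R) : 0 < c -> c < 1 -> (Num.sqrt 2)^-1 < c ->
  F1 c = (Num.sqrt 2 * c)^-1%:E.
Proof.
move=> c0 c1 c2; apply/eqP; rewrite eq_le; apply/andP; split.
  apply: le_trans (annulus_sup1X c0).
  apply: ereal_inf_lbound; exists 1; first exact: sphere_poly1_1.
  by exists ((Num.sqrt 2)%:C *: 'X) => //; exact: sphere_poly1_sqrt2X.
by apply: le_ereal_inf_tmp => _ [p sp [q sq <-]]; exact: annulus_sup_ge_inner.
Qed.

(** For the optimal [M], M^2 * 2 c^2 = 1, so the inequality of means becomes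
    a sum of two nonnegative terms being at most 0; this forces p_1 = 0 and
    q_0 = 0, and the norms give the moduli of the other two coefficients. *)
Lemma extremal_pair_unique (R : realType) (c : R) (p q : {poly R[i]}) :
  0 < c -> c < 1 -> (Num.sqrt 2)^-1 < c -> extremal_pair c p q ->
  exists s t : R,
    p = (cexpi s)%:P /\ q = (cexpi t * (Num.sqrt 2)%:C) *: 'X.
Proof.
move=> c0 c1 c2 [/sphere_poly1P[sp np] /sphere_poly1P[sq nq] hs].
have hM : (annulus_sup c p q <= (Num.sqrt 2 * c)^-1%:E)%E by rewrite hs F1_large.
have := mean_at_inner_radius c0 c1 sp sq np nq hM.
have c22 := sqrt2_inv_lt_sqr c2.
rewrite inner_value_sqr [X in _ <= X]mulrBr mulVf; last by rewrite gt_eqF//; lra.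
rewrite lerBrDr -addrA gerDl => h.
have hp : 0 <= cmod p`_1 ^+ 2 * (c ^+ 2 - 2^-1) by rewrite mulr_ge0 ?sqr_ge0//; lra.
have hq : 0 <= (2 * c ^+ 2)^-1 * (cmod q`_0 ^+ 2 * (2 * c ^+ 2 - 1)).
  apply: mulr_ge0; first by rewrite invr_ge0; lra.
  by rewrite mulr_ge0 ?sqr_ge0//; lra.
have : cmod p`_1 ^+ 2 * (c ^+ 2 - 2^-1)
    + (2 * c ^+ 2)^-1 * (cmod q`_0 ^+ 2 * (2 * c ^+ 2 - 1)) == 0.
  by rewrite eq_le h addr_ge0.
have n1 : c ^+ 2 - 2^-1 != 0 by rewrite gt_eqF//; lra.
have n2 : (2 * c ^+ 2)^-1 != 0 by rewrite invr_eq0 gt_eqF//; lra.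
have n3 : 2 * c ^+ 2 - 1 != 0 by rewrite gt_eqF//; lra.
rewrite paddr_eq0// mulf_eq0 (negbTE n1) orbF => /andP[/eqP p10].
rewrite mulf_eq0 (negbTE n2) /= mulf_eq0 (negbTE n3) orbF => /eqP q00.
move: np nq; rewrite /coef_norm_sqr p10 q00 mul0r addr0 add0r => np nq.
have [s es] : exists s, p`_0 = cexpi s.
  by apply: cmod1_cexpi; apply/eqP; rewrite -(@eqrXn2 _ 2) ?cmod_ge0// np expr1n.
have s0 : 0 < Num.sqrt (2 : R) by rewrite sqrtr_gt0.
have s0c : (Num.sqrt (2 : R))%:C != 0 by rewrite eq_complex /= eqxx andbT gt_eqF.
have [t et] : exists t, q`_1 / (Num.sqrt 2)%:C = cexpi t.
  apply: cmod1_cexpi; apply: (@mulIf _ (Num.sqrt 2)); first by rewrite gt_eqF.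
  rewrite mul1r -[X in _ * X](cmod_real (ltW s0)) -cmodM divfK//.
  by apply/eqP; rewrite -(@eqrXn2 _ 2) ?cmod_ge0 ?sqrtr_ge0// sqr_sqrtr//; lra.
exists s, t; rewrite -et -es divfK//; split.
  by rewrite {1}(poly_size2E sp) (cmod_eq0 p10) scale0r addr0.
by rewrite {1}(poly_size2E sq) (cmod_eq0 q00) polyC0 add0r.
Qed.

Theorem mainTheorem11 (R : realType) (c : R) (c_gt0 : 0 < c) (c_lt1 : c < 1) :
  F1 c = (if c <= (Num.sqrt 2)^-1 then 1 else (Num.sqrt 2 * c)^-1)%:E /\
  ((Num.sqrt 2)^-1 < c ->
     extremal_pair c 1 ((Num.sqrt 2)%:C *: 'X) /\
     (forall p q : {poly R[i]}, extremal_pair c p q ->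
        exists s t : R,
          p = (cexpi s)%:P /\ q = (cexpi t * (Num.sqrt 2)%:C) *: 'X)).
Proof.
split.
  by case: leP => c2; [exact: F1_small|exact: F1_large].
move=> c2; split; last by move=> p q; exact: extremal_pair_unique.
split; [exact: sphere_poly1_1|exact: sphere_poly1_sqrt2X|].
apply/eqP; rewrite eq_le F1_large// annulus_sup1X//=.
by apply: annulus_sup_ge_inner => //; [exact: sphere_poly1_1|exact: sphere_poly1_sqrt2X].
Qed.
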